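(* Let $L$ be a diassociative A-loop. Then the map $T:L\to \mathrm{Mlt}_1(L)$, $x\mapsto T(x)=R(x)L(x)^{-1}$, is a homomorphism, i.e. $T(x)T(y)=T(xy)$ for all $x,y\in L$.
   Context: A loop $(L,\cdot)$ is a nonempty set $L$ with a binary operation $\cdot$ (usually written as juxtaposition) such that (i) for all $a,b\in L$ the equations $ax=b$ and $ya=b$ each have unique solutions $x,y\in L$, and (ii) there is an identity element $1\in L$ with $1x=x1=x$ for all $x\in L$. Maps are written on the right of their arguments and composed left to right: $z(\varphi\psi)=(z\varphi)\psi$. For $x\in L$ the left and right translations are the permutations of $L$ defined by $yL(x)=xy$ and $yR(x)=yx$. The multiplication group $\mathrm{Mlt}(L)$ is the permutation group on $L$ generated by all $L(x),R(x)$, $x\in L$. The inner mapping group $\mathrm{Mlt}_1(L)$ is the subgroup of $\mathrm{Mlt}(L)$ fixing $1$; its elements are the inner mappings. The middle inner mapping is $T(x)=R(x)L(x)^{-1}\in\mathrm{Mlt}_1(L)$. An A-loop is a loop in which every inner mapping is an automorphism of $L$. A loop $L$ is diassociative if for all $x,y\in L$ the subloop $\langle x,y\rangle$ generated by $x,y$ is a group. *)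

(* Defs.v *)
From HB Require Import structures.
From mathcomp Require Import all_boot.
From mathcomp Require Import boolp classical_sets.

Set Implicit Arguments.
Unset Strict Implicit.
Unset Printing Implicit Defensive.

Local Open Scope group_scope.
Local Open Scope classical_set_scope.

(* The product [*] and the identity [1] are those of
   [baseUMagmaType], whose carrier is an arbitrary (possibly infinite) type. *)
HB.mixin Record BaseUMagma_isLoop L of BaseUMagma L := {
  loop_mul1l : left_id (1 : L) mul;
  loop_mul1r : right_id (1 : L) mul;
  loop_ldivP : forall a b : L, exists! x : L, a * x = b;
  loop_rdivP : forall a b : L, exists! y : L, y * a = b
}.

#[short(type="loopType")]
HB.structure Definition Loop := {L of BaseUMagma_isLoop L & BaseUMagma L}.

Bind Scope group_scope with Loop.sort.

Section LoopDefs.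
Variable L : loopType.
Implicit Types (a b x y z : L) (f g : L -> L) (S : set L).

Lemma ldiv_ex a b : exists x, a * x = b.
Proof. by have [x [xP _]] := loop_ldivP a b; exists x. Qed.

Lemma rdiv_ex a b : exists y, y * a = b.
Proof. by have [y [yP _]] := loop_rdivP a b; exists y. Qed.

(* [ldiv a b] is the solution of [a x = b], [rdiv a b] that of [y a = b]. *)
Definition ldiv a b : L := projT1 (cid (ldiv_ex a b)).
Definition rdiv a b : L := projT1 (cid (rdiv_ex a b)).

Definition ltrans x : L -> L := fun y => x * y.
Definition rtrans x : L -> L := fun y => y * x.

(* [ldiv x] is the inverse permutation of [ltrans x]. *)
Lemma ldivK x : cancel (ldiv x) (ltrans x).
Proof. by move=> y; rewrite /ltrans /ldiv; case: cid. Qed.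

Lemma ltransK x : cancel (ltrans x) (ldiv x).
Proof.
move=> y; have [z [_ zU]] := loop_ldivP x (x * y).
by rewrite -[RHS](zU y erefl); symmetry; apply: zU; apply: ldivK.
Qed.

(* Maps act on the right: the product of permutations is [f \; g], i.e. f
   first, then g. *)
Inductive Mlt : (L -> L) -> Prop :=
| Mlt_ltrans x : Mlt (ltrans x)
| Mlt_rtrans x : Mlt (rtrans x)
| Mlt_id : Mlt id
| Mlt_comp f g : Mlt f -> Mlt g -> Mlt (f \; g)
| Mlt_inv f g : Mlt f -> cancel f g -> cancel g f -> Mlt g.

Definition inner_mapping f := Mlt f /\ f 1 = 1.

Definition T x : L -> L := rtrans x \; ldiv x.

Definition loop_automorphism f :=
  bijective f /\ {morph f : x y / x * y}.

Definition subloop S :=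
  [/\ S 1,
      forall x y, S x -> S y -> S (x * y),
      forall x y, S x -> S y -> S (ldiv x y) &
      forall x y, S x -> S y -> S (rdiv x y)].

Definition subloop_gen x y : set L := smallest subloop [set x; y].

Definition is_group_on S :=
  [/\ forall u v, S u -> S v -> S (u * v),
      forall u v w, S u -> S v -> S w -> u * (v * w) = u * v * w &
      exists e, [/\ S e,
        forall u, S u -> e * u = u /\ u * e = u &
        forall u, S u -> exists v, [/\ S v, u * v = e & v * u = e]]].

End LoopDefs.

Definition A_loop (L : loopType) :=
  forall f : L -> L, inner_mapping f -> loop_automorphism f.

Definition diassociative (L : loopType) :=
  forall x y : L, is_group_on (subloop_gen x y).

(* Main.v *)
(** Diassociativity makes every inner mapping built from translations by
   elements of the group [<x, y>] and fixing [x] and [y] an automorphism that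
   commutes with all these translations. Two such mappings are
   [R x y = R(x) R(y) R(xy)^-1] and [M x y = L(x) R(y) L(x)^-1 R(y)^-1].
   For any [x, y, z] the mappings [M z y], [R x y] and [R z x] all send
   [z (x y)] to [(z x) y]. Comparing them, together with their compatibility
   with inversion and conjugation, gives [R y x = (R x y)^-1]. Since [T y] is an
   automorphism, [R x y = M x y (R y x)], hence [M x y = (R x y)^2], and this is
   exactly the obstruction to [T x T y = T (x y)]. *)
Require Import Defs.
From mathcomp Require Import all_boot.
From mathcomp Require Import boolp classical_sets.

Set Implicit Arguments.
Unset Strict Implicit.
Unset Printing Implicit Defensive.

Local Open Scope group_scope.

Section Loop.
Variable L : loopType.
Implicit Types (u v w x y z : L) (f : L -> L).

(** * Inverses, generated subloops and the three mappings *)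

Definition linv x : L := ldiv x 1.
Local Notation "x ^-1" := (linv x) : group_scope.

Lemma mul1l x : 1 * x = x. Proof. exact: loop_mul1l. Qed.
Lemma mul1r x : x * 1 = x. Proof. exact: loop_mul1r. Qed.

Lemma mullI x : injective (fun y => x * y).
Proof. exact: can_inj (ltransK x). Qed.

Lemma mulVr x : x * x^-1 = 1. Proof. exact: (ldivK x 1). Qed.

Lemma subloop_subloop_gen x y : subloop (subloop_gen x y).
Proof.
split=> [S [[]]|u v Su Sv S SP|u v Su Sv S SP|u v Su Sv S SP] //.
- by case: (SP) => -[_ H _ _] _; apply: H; [apply: Su|apply: Sv].
- by case: (SP) => -[_ _ H _] _; apply: H; [apply: Su|apply: Sv].
- by case: (SP) => -[_ _ _ H] _; apply: H; [apply: Su|apply: Sv].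
Qed.

Lemma gen_l x y : subloop_gen x y x.
Proof. by move=> S [_]; apply; left. Qed.

Lemma gen_r x y : subloop_gen x y y.
Proof. by move=> S [_]; apply; right. Qed.

Lemma genM x y u v :
  subloop_gen x y u -> subloop_gen x y v -> subloop_gen x y (u * v).
Proof. by case: (subloop_subloop_gen x y) => _ + _ _; apply. Qed.

Lemma genV x y u : subloop_gen x y u -> subloop_gen x y u^-1.
Proof. by case: (subloop_subloop_gen x y) => S1 _ + _ Su; apply. Qed.

Definition conj x u : L := x^-1 * (u * x).
Definition R x y u : L := u * x * y * (x * y)^-1.
Definition M x y u : L := x^-1 * (x * u * y) * y^-1.

Section Diassociative.
Hypothesis diaL : diassociative L.

(** Later appeals to diassociativity all go through this lemma: any three words in two elements
    associate. *)
Lemma gen_mulA x y u v w :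
    subloop_gen x y u -> subloop_gen x y v -> subloop_gen x y w ->
  u * (v * w) = u * v * w.
Proof. by case: (diaL x y) => _ + _; apply. Qed.

Local Ltac gen := do ?[exact: gen_l|exact: gen_r|apply: genM|apply: genV].
Local Ltac dia x y := apply: (@gen_mulA x y); gen.

Lemma mulVl x : x^-1 * x = 1.
Proof.
apply: (@mullI x); rewrite /= mul1r.
have -> : x * (x^-1 * x) = x * x^-1 * x by dia x x.
by rewrite mulVr mul1l.
Qed.

Lemma mulKl x y : x^-1 * (x * y) = y.
Proof.
have -> : x^-1 * (x * y) = x^-1 * x * y by dia x y.
by rewrite mulVl mul1l.
Qed.

Lemma mulVKl x y : x * (x^-1 * y) = y.
Proof.
have -> : x * (x^-1 * y) = x * x^-1 * y by dia x y.
by rewrite mulVr mul1l.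
Qed.

Lemma mulKr x y : y * x * x^-1 = y.
Proof.
have <- : y * (x * x^-1) = y * x * x^-1 by dia x y.
by rewrite mulVr mul1r.
Qed.

Lemma mulVKr x y : y * x^-1 * x = y.
Proof.
have <- : y * (x^-1 * x) = y * x^-1 * x by dia x y.
by rewrite mulVl mul1r.
Qed.

Lemma invK x : x^-1^-1 = x.
Proof. by apply: (@mullI x^-1); rewrite /= mulVr mulVl. Qed.

Lemma invM x y : (x * y)^-1 = y^-1 * x^-1.
Proof.
apply: (@mullI (x * y)); rewrite /= mulVr.
have -> : x * y * (y^-1 * x^-1) = x * y * y^-1 * x^-1 by dia x y.
by rewrite mulKr mulVr.
Qed.

Lemma T_conj x : T x = conj x.
Proof.
apply/funext => u; apply: (@mullI x); rewrite /conj /= mulVKl.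
exact: (ldivK x (u * x)).
Qed.

Lemma conjA x u : conj x u = x^-1 * u * x.
Proof. by rewrite /conj; dia x u. Qed.

Lemma mul_conj x u : x * conj x u = u * x.
Proof. exact: mulVKl. Qed.

Lemma conj_id x : conj x x = x.
Proof. exact: mulKl. Qed.

Lemma conjM x u : conj x (x * u) = u * x.
Proof. by rewrite conjA mulKl. Qed.

Lemma conjVK x u : conj x (conj x^-1 u) = u.
Proof. by rewrite {2}/conj invK conjM mulVKr. Qed.

Lemma R_fixl x y : R x y x = x.
Proof.
rewrite /R; have <- : x * (x * y) = x * x * y by dia x y.
by rewrite mulKr.
Qed.

Lemma R_fixr x y : R x y y = y.
Proof.
rewrite /R; have <- : y * (x * y) = y * x * y by dia x y.
by rewrite mulKr.
Qed.

Lemma M_fixl x y : M x y x = x.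
Proof.
rewrite /M; have <- : x * (x * y) = x * x * y by dia x y.
by rewrite mulKl mulKr.
Qed.

Lemma M_fixr x y : M x y y = y.
Proof.
rewrite /M; have <- : x * (y * y) = x * y * y by dia x y.
by rewrite mulKl mulKr.
Qed.

(** * Inner mappings as automorphisms *)

Section ALoop.
Hypothesis autL : A_loop L.

Lemma conj_inner x : inner_mapping (conj x).
Proof.
split; last by rewrite /conj mul1l mulVl.
exact: (Mlt_comp (Mlt_rtrans x) (Mlt_ltrans x^-1)).
Qed.

Lemma conj_morph x : {morph conj x : u v / u * v}.
Proof. by case: (autL (conj_inner x)). Qed.

Lemma R_morph x y : {morph R x y : u v / u * v}.
Proof.
have [//|_ //] := autL (f := R x y) _.
split; last by rewrite /R mul1l mulVr.
exact: Mlt_comp (Mlt_comp (Mlt_rtrans x) (Mlt_rtrans y)) (Mlt_rtrans (x * y)^-1).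
Qed.

Lemma M_morph x y : {morph M x y : u v / u * v}.
Proof.
have [//|_ //] := autL (f := M x y) _.
split; last by rewrite /M mul1r mulKl mulVr.
exact: Mlt_comp (Mlt_comp (Mlt_ltrans x) (Mlt_rtrans y))
  (Mlt_comp (Mlt_ltrans x^-1) (Mlt_rtrans y^-1)).
Qed.

Lemma morphV f : {morph f : u v / u * v} -> {morph f : u / u^-1}.
Proof.
move=> fM u; have f1 : f 1 = 1.
  by apply: (@mullI (f 1)); rewrite /= -fM !mul1r.
by apply: (@mullI (f u)); rewrite /= -fM !mulVr.
Qed.

Let conjV x := morphV (conj_morph x).
Let RV x y := morphV (@R_morph x y).
Let MV x y := morphV (@M_morph x y).

Lemma morph_conj f x u :
  {morph f : u v / u * v} -> f (conj x u) = conj (f x) (f u).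
Proof. by move=> fM; rewrite /conj !fM (morphV fM). Qed.

Lemma morph_R f x y u :
  {morph f : u v / u * v} -> f (R x y u) = R (f x) (f y) (f u).
Proof. by move=> fM; rewrite /R !fM (morphV fM) fM. Qed.

Lemma morph_M f x y u :
  {morph f : u v / u * v} -> f (M x y u) = M (f x) (f y) (f u).
Proof. by move=> fM; rewrite /M !fM !(morphV fM). Qed.

(** An automorphism fixing [x] and [y] acts only on the factor [u], and the outer factors cancel the
    inverses in [M x y u]. So [M x y] moves brackets. *)
Lemma M_assoc x y u : M x y (x * (u * y)) = x * u * y.
Proof. by rewrite !M_morph M_fixl M_fixr /M mulVKr mulVKl. Qed.

Lemma R_assoc x y u : R x y (u * (x * y)) = u * x * y.
Proof. by rewrite !R_morph R_fixl R_fixr /R mulVKr. Qed.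

Lemma M_invl x y u : M x^-1 y (x * u * y) = x * (u * y).
Proof.
have := M_assoc x^-1 y (x * u); rewrite mulKl M_morph M_fixl => <-.
by rewrite mulVKl.
Qed.

Lemma M_invr x y u : M x y^-1 (x * u * y) = x * (u * y).
Proof.
have fix_y : M x y^-1 y = y.
  by rewrite -[RHS]invK -[in RHS](M_fixr x y^-1) MV invK.
rewrite M_morph fix_y -[u in M _ _ (x * u)](mulKr y).
by rewrite M_assoc mulVKr.
Qed.

Lemma MK x y : cancel (M x y) (M x^-1 y).
Proof.
move=> u; have -> : u = x * (x^-1 * u * y^-1 * y) by rewrite mulVKr mulVKl.
by rewrite M_assoc M_invl.
Qed.

(** [M x y^-1] undoes [M x y] by [M_invr] and is itself undone by [M x^-1 y^-1] by [MK]. *)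
Lemma MVV x y : M x^-1 y^-1 = M x y.
Proof.
apply/funext => u; have -> : u = x * (x^-1 * u * y^-1 * y).
  by rewrite mulVKr mulVKl.
by rewrite M_assoc -M_invr MK.
Qed.

(** Inversion reverses products, so it exchanges the two bracketings as well as the roles of [x] and
    [y]. *)
Lemma M_sym x y : M y x = M x^-1 y.
Proof.
apply/funext => u; have -> : u = x * (x^-1 * (u * y^-1)) * y.
  by rewrite mulVKl mulVKr.
rewrite M_invl; move: (x^-1 * _) => w.
have -> : x * w * y = (y^-1 * (w^-1 * x^-1))^-1 by rewrite !invM !invK.
by rewrite MV -(MVV y x) M_assoc !invM !invK.
Qed.

Lemma R_inv_assoc x y u : R y^-1 x^-1 (u * x * y) = u * (x * y).
Proof. by rewrite /R !mulKr invM !invK. Qed.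

Lemma RK x y : cancel (R y^-1 x^-1) (R x y).
Proof.
move=> u; rewrite -[u](mulVKr y) -[u * y^-1](mulVKr x).
by rewrite R_inv_assoc R_assoc.
Qed.

Lemma R_linv_assoc x y u : R y^-1 x^-1 (x * y * u) = x * (y * u).
Proof.
have -> : x * y * u = (u^-1 * (y^-1 * x^-1))^-1 by rewrite !invM !invK.
by rewrite RV R_assoc !invM !invK.
Qed.

Lemma R_lassoc x y u : R x y (x * (y * u)) = x * y * u.
Proof. by rewrite -R_linv_assoc RK. Qed.

(** * Comparison of the mappings [R] and [M] *)

(** Both automorphisms send [z * (x * v)] to [z * x * v] and fix [z], which cancels. *)
Lemma R_M z x v : R z x (x * v) = M z v (x * v).
Proof.
have := R_lassoc z x v; rewrite -M_assoc R_morph R_fixl M_morph M_fixl.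
exact: mullI.
Qed.

Lemma M_conjl x y z : M (conj x z) y x = M z y x.
Proof.
(* By [R_M] both sides equal [R z x w * x], since [R z x] fixes [x]. *)
have conj_xM w : conj x (M z w (x * w)) = M z (conj x w) (w * x).
  rewrite -R_M R_morph R_fixr conjM -(mul_conj x w) -R_M mul_conj.
  by rewrite R_morph R_fixr.
pose w := conj x^-1 y; have wy : conj x w = y by exact: conjVK.
have := conj_xM w; rewrite morph_M; last exact: conj_morph.
rewrite conjM -mul_conj wy !M_morph !M_fixr.
by move=> /(congr1 (fun t => t * y^-1)); rewrite !mulKr.
Qed.

Lemma M_conjr x y z : M z (conj x y) x = M z y x.
Proof. by rewrite ![M z _]M_sym -conjV M_conjl. Qed.

(** Through [R_M], the left side at [u] is [M x^-1 (y * u) u]. The right side, computed at [u^-1]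
    and inverted, is [M x (y^-1 * u^-1) u]. Conjugating its second parameter by [u], which [M_conjr]
    allows, gives [(y * u)^-1], and [MVV] concludes. *)
Lemma R_VV x y : R x^-1 y^-1 = R x y.
Proof.
have R_E z t v : R z t v = M z (t^-1 * v) v by rewrite -{1 3}(mulVKl t v) R_M.
apply/funext => u; rewrite R_E invK -[RHS]invK -RV R_E -MV invK.
by rewrite -(M_conjr u (y^-1 * _)) /conj mulVKr -invM -MVV invK.
Qed.

(** [R y x] fixes [y], so it commutes with the automorphism [conj y]. *)
Lemma R_conj x y u : R y (conj y x) u = R y x u.
Proof.
rewrite -(conjVK y u).
rewrite [RHS]morph_conj; last exact: R_morph.
by rewrite R_fixl morph_R ?conj_id //; apply: conj_morph.
Qed.

Lemma M_conj x y u : M (conj y x) y u = M x y u.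
Proof.
rewrite -(conjVK y u).
rewrite [RHS]morph_conj; last exact: M_morph.
by rewrite M_fixr morph_M ?conj_id //; apply: conj_morph.
Qed.

Lemma RC x y : cancel (R x y) (R y x).
Proof. by move=> u; rewrite -(R_VV x y) RK. Qed.

(* Compute [conj y (v * x)] directly and as [conj y v * conj y x]. *)
Lemma M_R x y u : M x y (R y x u) = R x y u.
Proof.
have -> : u = y^-1 * (y * u * (x * y)^-1 * (x * y)) by rewrite mulVKr mulKl.
move: (y * u * _) => v.
transitivity (conj y (v * x)); last first.
  by rewrite R_morph RV R_fixr R_assoc.
rewrite conj_morph /(conj y v) -M_assoc -[v * y * _]R_assoc mul_conj.
rewrite -M_sym M_conj; congr (M _ _ _).
by rewrite R_conj R_morph RV R_fixl.
Qed.

Lemma M_RR x y u : M x y u = R x y (R x y u).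
Proof. by rewrite -M_R RC. Qed.

Lemma conj_comp x y u : conj y (conj x u) = conj (x * y) u.
Proof.
(* Inserting [M x^-1 y] after [M x y], the latter split as two copies of [R x y], lets each factor
   move one bracket; [y^-1] is fixed and comes out in front. *)
rewrite -[RHS](MK x y) (M_RR x y) -[LHS]/(y^-1 * (conj x u * y)).
have -> : conj x u * y = M x^-1 y (R x y (x^-1 * (u * (x * y)))).
  by rewrite R_morph RV R_fixl R_assoc M_assoc.
have -> : R x y (conj (x * y) u) = y^-1 * (x^-1 * (u * (x * y))).
  by rewrite -[RHS](RK x y) R_lassoc -invM.
by rewrite [in RHS]R_morph RV R_fixr [in RHS]M_morph MV M_fixr.
Qed.

End ALoop.
End Diassociative.
End Loop.

Theorem lemma1 (L : loopType) (hdi : diassociative L) (hA : A_loop L) :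
  (forall x : L, inner_mapping (T x)) /\
  (forall x y : L, T x \; T y = T (x * y)).
Proof.
split=> [x|x y]; rewrite !T_conj //; first exact: conj_inner.
by apply/funext => u; apply: conj_comp.
Qed.
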